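(* Let $G$ be a tree, let $\ell\ge 3$, and let $\mathbf{x}=(x_0,\dots,x_\ell)$ be a path in $G$. Then there exists an isomorphism of chain complexes \[ (MC_{\ast+2,\ell}(\mathbf{x}),\partial)\cong(C_\ast(\Delta^{\ell-2},\Delta_{\mathbf{x}}),-\partial). \]
   Context: A tree is a finite connected graph (no loops or multiple edges) without cycles; $V(G)$ is its vertex set and $d$ the shortest-path distance. A path in $G$ is a tuple $(x_0,\dots,x_k)\in V(G)^{k+1}$, $k\ge1$, with $d(x_i,x_{i+1})=1$ for all $0\le i\le k-1$ (vertices may repeat); its length is $k$. For a tuple $(y_0,\dots,y_k)\in V(G)^{k+1}$ with $y_j\neq y_{j+1}$ for all $j$ (and $k\ge 1$) there is, since $G$ is a tree, a unique shortest path passing through $y_0,\dots,y_k$ in this order, starting at $y_0$ and ending at $y_k$ (the concatenation of the geodesics from $y_j$ to $y_{j+1}$); it is called the path of $(y_0,\dots,y_k)$. $MC_{k,\ell}(\mathbf{x})$ is the free $\mathbb{Z}$-module generated by the tuples $(y_0,\dots,y_k)\in V(G)^{k+1}$ with $y_j\ne y_{j+1}$ for all $j$, $\sum_{j=0}^{k-1}d(y_j,y_{j+1})=\ell$, and whose path is $\mathbf{x}$. It is a chain complex with $\partial=\sum_{i=1}^{k-1}(-1)^i\partial_i$, where $\partial_i(y_0,\dots,y_k)=(y_0,\dots,\hat{y}_i,\dots,y_k)$ (removal of $y_i$) if $d(y_{i-1},y_{i+1})=d(y_{i-1},y_i)+d(y_i,y_{i+1})$ and $0$ otherwise. $MC_{\ast+2,\ell}(\mathbf{x})$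 is the chain complex $D_\ast$ with $D_i=MC_{i+2,\ell}(\mathbf{x})$ for $i\ge0$, $D_i=0$ for $i<0$, whose differential $D_i\to D_{i-1}$ is that of $MC_{\ast,\ell}(\mathbf{x})$ in degree $i+2$ for $i\ge1$ and $0$ for $i\le0$. Let $i_1<\dots<i_m$ be all the indices $i$ with $0<i<\ell$ and $d(x_{i-1},x_{i+1})<d(x_{i-1},x_i)+d(x_i,x_{i+1})$ (possibly $m=0$). $\Delta^{\ell-2}$ is the simplicial complex of all nonempty subsets of $\{1,\dots,\ell-1\}$, and $\Delta_{\mathbf{x}}$ is its subcomplex $\{\sigma\in\Delta^{\ell-2}\mid\{i_1,\dots,i_m\}\not\subset\sigma\}$. For a simplicial complex $S$ on $\{1,\dots,\ell-1\}$, $C_n(S)$ is the free $\mathbb{Z}$-module on simplices with $n+1$ elements ($n\ge0$), with $\partial\{s_0<\dots<s_n\}=\sum_{i=0}^n(-1)^i\{s_0,\dots,\hat{s}_i,\dots,s_n\}$ for $n\ge1$ and $\partial=0$ on $C_0(S)$; for a subcomplex $S'$, $C_\ast(S,S')=C_\ast(S)/C_\ast(S')$, and $-\partial$ means its differential with opposite sign. *)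

(* Defs.v *)
From HB Require Import structures.
From mathcomp Require Import all_boot all_algebra zify.

Set Implicit Arguments.
Unset Strict Implicit.
Unset Printing Implicit Defensive.

Import GRing.Theory.
Local Open Scope ring_scope.

(** A complex [C] stands for the complex indexed by the integers that is zero
    in negative degrees: the differential out of [C 0] is the zero map into the
    zero group and is not recorded. *)

Record chain_complex := ChainComplex {
  chain :> nat -> zmodType;
  diff : forall n, {additive chain n.+1 -> chain n};
  diffK : forall n (c : chain n.+2), diff n (diff n.+1 c) = 0
}.

Definition chain_iso (C D : chain_complex) : Prop :=
  exists f : forall n, {additive C n -> D n},
    (forall n, bijective (f n)) /\
    (forall n (c : C n.+1), f n (diff C n c) = diff D n (f n.+1 c)).

Section Shift.

Variable C : chain_complex.

Lemma shift2_diffK n (c : C n.+4) : diff C n.+2 (diff C n.+3 c) = 0.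
Proof. exact: diffK. Qed.

(** [shift2 C] is [C 2 <- C 3 <- ...] with [C 2] placed in degree [0]; the
    differential of [C] from degree [2] to degree [1] is discarded. *)
Definition shift2 : chain_complex :=
  @ChainComplex (fun n => C n.+2) (fun n => diff C n.+2) shift2_diffK.

Lemma opp_diffK n (c : C n.+2) : (\- diff C n) ((\- diff C n.+1) c) = 0.
Proof. by rewrite /= raddfN opprK diffK. Qed.

Definition opp_diff : chain_complex :=
  @ChainComplex C (fun n => \- diff C n) opp_diffK.

End Shift.

Record subcomplex (C : chain_complex) := Subcomplex {
  subchain :> forall n, zmodClosed (C n);
  subchain_diff : forall n (c : C n.+1),
    c \in subchain n.+1 -> diff C n c \in subchain n
}.

Section QuotientComplex.

Variables (C : chain_complex) (P : subcomplex C).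
Local Open Scope quotient_scope.

Definition quot_chain n : zmodType := Quotient.quot (P n).

Definition quot_diff n (q : quot_chain n.+1) : quot_chain n :=
  \pi_(quot_chain n) (diff C n (repr q)).

Lemma quot_diffE n (c : C n.+1) :
  quot_diff (\pi_(quot_chain n.+1) c) = \pi_(quot_chain n) (diff C n c).
Proof.
apply/eqP; rewrite -Quotient.idealrBE -raddfB subchain_diff //.
by rewrite Quotient.idealrBE reprK.
Qed.

Lemma quot_diff_is_zmod_morphism n : zmod_morphism (@quot_diff n).
Proof.
move=> q r; rewrite -[q]reprK -[r]reprK -(raddfB (\pi_(quot_chain n.+1))).
by rewrite !quot_diffE !raddfB.
Qed.

HB.instance Definition _ n :=
  GRing.isZmodMorphism.Build (quot_chain n.+1) (quot_chain n) (@quot_diff n)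
    (@quot_diff_is_zmod_morphism n).

Lemma quot_diffK n (q : quot_chain n.+2) : quot_diff (quot_diff q) = 0.
Proof. by rewrite -[q]reprK !quot_diffE diffK raddf0. Qed.

Definition quot_complex : chain_complex :=
  @ChainComplex quot_chain (fun n => @quot_diff n : {additive _ -> _})
    quot_diffK.

End QuotientComplex.

Notation freeZ S := {ffun S -> int}.

Section Free.

Variables (T : eqType) (P : pred T) (S : subFinType P).

(** The basis vector of [freeZ S] attached to [t] when [P t] holds.  It is [0]
    when [P t] fails; this does not occur in the differentials below, by
    [mc_face_closed] and [faces_face_closed]. *)
Definition basis (t : T) : freeZ S := [ffun s => (val s == t)%:R].

Definition linext (M : zmodType) (F : S -> M) (c : freeZ S) : M :=
  \sum_s F s *~ c s.

Lemma linext_is_zmod_morphism (M : zmodType) (F : S -> M) :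
  zmod_morphism (linext F).
Proof.
move=> c d; rewrite /linext -sumrB; apply: eq_bigr => s _.
by rewrite !ffunE mulrzBr.
Qed.

HB.instance Definition _ (M : zmodType) (F : S -> M) :=
  GRing.isZmodMorphism.Build (freeZ S) M (linext F)
    (linext_is_zmod_morphism F).

Lemma linext_basis (M : zmodType) (F : T -> M) (t : T) :
  P t -> linext (fun s => F (val s)) (basis t) = F t.
Proof.
move=> Pt; rewrite /linext (bigD1 (Sub t Pt)) //= ffunE SubK eqxx mulr1z.
rewrite big1 ?addr0 // => s ne_s; rewrite ffunE.
case: eqP => [E|_]; last exact: mulr0z.
by move: ne_s; rewrite -val_eqE /= SubK E eqxx.
Qed.

Lemma sum_antisym (I : finType) (F : I -> I -> freeZ S) :
    (forall p q, p != q -> F p q = - F q p) ->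
  \sum_p \sum_(q | q != p) F p q = 0.
Proof.
move=> FN; set X := LHS.
have XN : X = - X.
  rewrite {1}/X (exchange_big_dep predT) //= -sumrN; apply: eq_bigr => p _.
  rewrite -sumrN; apply: eq_big => q; first by rewrite eq_sym.
  by rewrite eq_sym => /FN.
apply/ffunP => s; rewrite !ffunE; have := congr1 (fun f : freeZ S => f s) XN.
rewrite !ffunE; move: (X s : int) => z; exact: (ltac:(lia) : z = - z -> z = 0).
Qed.

End Free.

Lemma sign_unbump (p q : nat) : p != q ->
  (-1) ^+ (p + unbump p q) = - (-1) ^+ (q + unbump q p) :> int.
Proof.
wlog lt_pq : p q / (p < q)%N => [W ne_pq|_].
  have [/W->//|lt_qp|/eqP] := ltngtP p q; last by rewrite (negPf ne_pq).
  by rewrite (W q p) ?opprK // eq_sym.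
have -> : unbump q p = p by rewrite /unbump ltnNge ltnW ?subn0.
have -> : unbump p q = q.-1 by rewrite /unbump lt_pq subn1.
by case: q lt_pq => // q _; rewrite addnC addSn exprS mulN1r opprK.
Qed.

Record tree := Tree {
  vertex :> finType;
  adj : rel vertex;
  adj_sym : symmetric adj;
  adj_irr : irreflexive adj;
  tree_connected : forall u v, connect adj u v;
  tree_acyclic : forall c : seq vertex,
    uniq c -> cycle adj c -> (size c <= 2)%N
}.

Section Tree.

Variable G : tree.
Implicit Types u v w : G.

Lemma walk_exists u v :
  exists n, [exists p : n.-tuple G, path (adj (t:=G)) u p && (last u p == v)].
Proof.
have /connectP[p pP ->] := tree_connected u v.
by exists (size p); apply/existsP; exists (in_tuple p); rewrite pP eqxx.
Qed.

Definition dist u v : nat := ex_minn (walk_exists u v).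

Lemma dist_le u (p : seq G) :
  path (adj (t:=G)) u p -> (dist u (last u p) <= size p)%N.
Proof.
move=> pP; rewrite /dist; case: ex_minnP => m _; apply.
by apply/existsP; exists (in_tuple p); rewrite pP eqxx.
Qed.

Lemma dist_walk u v : exists p : seq G,
  [/\ path (adj (t:=G)) u p, last u p = v & size p = dist u v].
Proof.
rewrite /dist; case: ex_minnP => m /existsP[p /andP[pP /eqP lp]] _.
by exists p; rewrite size_tuple.
Qed.

Lemma dist_triangle u v w : (dist u w <= dist u v + dist v w)%N.
Proof.
have [p [pP lp <-]] := dist_walk u v; have [q [qP lq <-]] := dist_walk v w.
rewrite -size_cat -lq -lp -last_cat; apply: dist_le.
by rewrite cat_path pP lp.
Qed.

Lemma distuu u : dist u u = 0%N.
Proof. by apply/eqP; rewrite -leqn0 (@dist_le u [::]). Qed.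

Lemma dist_eq0 u v : dist u v = 0%N -> u = v.
Proof. by have [[|w p] [_ <- <-]] := dist_walk u v. Qed.

(** A tuple [(y_0, ..., y_k)] is a [y : k.+1.-tuple G]; [pt y i] is [y_i],
    which is meaningful for [i <= k] only. *)

Definition pt k (y : k.+1.-tuple G) (i : nat) : G := tnth y (inord i).

Definition del k (i : 'I_k.+2) (y : k.+2.-tuple G) : k.+1.-tuple G :=
  [tuple tnth y (lift i j) | j < k.+1].

Definition is_path k (x : k.+1.-tuple G) : bool :=
  (0 < k)%N && [forall i : 'I_k, dist (pt x i) (pt x i.+1) == 1%N].

Definition consecutive_distinct k (y : k.+1.-tuple G) : bool :=
  [forall j : 'I_k, pt y j != pt y j.+1].

Definition len k (y : k.+1.-tuple G) : nat :=
  (\sum_(j < k) dist (pt y j) (pt y j.+1))%N.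

(** [a j] is the time at which the path [x] visits [y_j]. *)
Definition passes n k (x : n.+1.-tuple G) (y : k.+1.-tuple G) : bool :=
  [&& is_path x, pt x 0 == pt y 0, pt x n == pt y k &
    [exists a : {ffun 'I_k.+1 -> 'I_n.+1},
      [forall i : 'I_k.+1, forall j : 'I_k.+1, (i <= j)%N ==> (a i <= a j)%N] &&
      [forall j, tnth x (a j) == tnth y j]]].

(** In a tree, the shortest path through [y] is unique when consecutive entries
    of [y] are distinct, so this relation determines [x] from [y]. *)
Definition is_path_of n k (x : n.+1.-tuple G) (y : k.+1.-tuple G) : bool :=
  passes x y && [forall m : 'I_n, forall q : m.+1.-tuple G, ~~ passes q y].

Definition smooth k (i : nat) (y : k.+1.-tuple G) : bool :=
  dist (pt y i.-1) (pt y i.+1) ==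
    (dist (pt y i.-1) (pt y i) + dist (pt y i) (pt y i.+1))%N.

Section Magnitude.

Variables (l : nat) (x : l.+1.-tuple G).

Definition mc_mem k (y : k.+1.-tuple G) : bool :=
  [&& consecutive_distinct y, len y == l & is_path_of x y].

Definition MC k : zmodType := freeZ {y : k.+1.-tuple G | mc_mem y}.

Definition mc_face k (i : 'I_k.+2) (y : k.+2.-tuple G) : MC k :=
  if smooth i y then basis _ (del i y) else 0.

Definition mc_bd k (y : k.+2.-tuple G) : MC k :=
  \sum_(i < k.+2 | (0 < i < k.+1)%N) mc_face i y *~ (-1) ^+ i.

Definition mc_diff k : MC k.+1 -> MC k := linext (fun y => mc_bd (val y)).

HB.instance Definition _ k := GRing.Additive.on (@mc_diff k).

Lemma pt_del k (i : 'I_k.+2) (y : k.+2.-tuple G) j :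
  (j <= k)%N -> pt (del i y) j = pt y (bump i j).
Proof.
move=> le_jk; rewrite /pt tnth_mktuple; congr tnth; apply: val_inj.
by rewrite /= !inordK // /bump; lia.
Qed.

Lemma sum_dist_ge n (q : n.+1.-tuple G) i j :
  is_path q -> (i <= j <= n)%N -> (dist (pt q i) (pt q j) <= j - i)%N.
Proof.
case/andP=> _ /forallP qP; elim: j => [|j IHj] /andP[le_ij le_jn].
  by move: le_ij; rewrite leqn0 => /eqP->; rewrite distuu.
have [->|ne_ij] := eqVneq i j.+1; first by rewrite distuu.
have le_ij' : (i <= j <= n)%N by lia.
have /eqP := qP (Ordinal le_jn); have /= := IHj le_ij'.
have := dist_triangle (pt q i) (pt q j) (pt q j.+1); lia.
Qed.

Lemma passes_len n k (q : n.+1.-tuple G) (y : k.+1.-tuple G) :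
  passes q y -> (len y <= n)%N.
Proof.
case/and4P=> qP _ _ /existsP[a /andP[/forallP aM /forallP aE]].
suff H m : (m <= k)%N ->
    (\sum_(j < m) dist (pt y j) (pt y j.+1) <= a (inord m))%N.
  by rewrite /len (leq_trans (H k _)) // -ltnS ltn_ord.
elim: m => [|m IHm] lt_mk; first by rewrite big_ord0.
rewrite big_ord_recr /=; have {IHm} := IHm (ltnW lt_mk).
have aMm : (a (inord m) <= a (inord m.+1))%N.
  have /forallP/(_ (inord m.+1)) := aM (inord m).
  by rewrite !inordK; try lia; move=> /implyP; apply.
have := @sum_dist_ge n q (a (inord m)) (a (inord m.+1)) qP.
rewrite /pt !inord_val (eqP (aE _)) (eqP (aE _)) aMm -ltnS ltn_ord.
move=> /(_ isT) leH leIH; apply: leq_trans (leq_add leIH leH) _.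
by rewrite subnKC.
Qed.

Lemma len_del k (i : 'I_k.+2) (y : k.+2.-tuple G) :
  (0 < i < k.+1)%N -> smooth i y -> len (del i y) = len y.
Proof.
move=> /andP[i_gt0 lt_ik] sm.
pose d (t : nat) := dist (pt y t) (pt y t.+1).
have -> : len y = (\sum_(0 <= j < k.+1) d j)%N by rewrite big_mkord.
have -> : len (del i y) =
    (\sum_(0 <= j < k) dist (pt y (bump i j)) (pt y (bump i j.+1)))%N.
  rewrite big_mkord; apply: eq_bigr => j _.
  by rewrite !pt_del // ltnW.
rewrite (@big_cat_nat _ _ _ i.-1 0 k) //=; last by lia.
rewrite (@big_cat_nat _ _ _ i.-1 0 k.+1) //=; last by lia.
congr (_ + _)%N.
  apply: eq_big_nat => j /andP[_ lt_j]; rewrite /d /bump.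
  have -> : (i <= j)%N = false by lia.
  by have -> : (i <= j.+1)%N = false by lia.
rewrite big_ltn; last by lia.
rewrite [RHS]big_ltn; last by lia.
rewrite [X in _ = (_ + X)%N]big_ltn; last by lia.
rewrite addnA; congr (_ + _)%N.
  move/eqP: sm; rewrite /d /bump prednK // leqnn.
  by have -> : (i <= i.-1)%N = false by lia.
rewrite prednK // big_add1 /=.
apply: eq_big_nat => j /andP[le_ij _]; rewrite /d /bump le_ij.
by rewrite (leq_trans le_ij (leqnSn _)).
Qed.

Lemma mc_face_closed k (i : 'I_k.+2) (y : k.+2.-tuple G) :
  (0 < i < k.+1)%N -> smooth i y -> mc_mem y -> mc_mem (del i y).
Proof.
move=> iP sm /and3P[/forallP nd /eqP ly /andP[px sx]].
have ld : len (del i y) = l by rewrite len_del.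
apply/and3P; split; rewrite ?ld //.
  apply/forallP => j; rewrite !pt_del // 1?ltnW //.
  have lt_jk := ltn_ord j.
  have [lt_ji|lt_ij|E] := ltngtP j.+1 i.
  - have lt_j : (j < k.+1)%N by lia.
    have := nd (Ordinal lt_j); rewrite /= /bump.
    have -> : (i <= j)%N = false by lia.
    by have -> : (i <= j.+1)%N = false by lia.
  - have lt_j : (j.+1 < k.+1)%N by lia.
    have := nd (Ordinal lt_j); rewrite /= /bump.
    have -> : (i <= j)%N by lia.
    by have -> : (i <= j.+1)%N by lia.
  - rewrite /bump E leqnn (_ : (i <= j)%N = false); last by lia.
    apply/eqP => Ey; have lt_j : (j < k.+1)%N by lia.
    have /eqP := nd (Ordinal lt_j); apply; apply: dist_eq0 => /=.
    rewrite add0n add1n in Ey; have Ej : i.-1 = j by lia.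
    by move: sm; rewrite /smooth Ej -Ey distuu E; lia.
apply/andP; split; last first.
  apply/forallP => m; apply/forallP => q; apply/negP => /passes_len.
  by rewrite ld leqNgt ltn_ord.
case/and4P: px; rewrite /passes => -> /eqP x0 /eqP xl.
case/existsP=> a /andP[/forallP aM /forallP aE].
rewrite !pt_del // /bump (_ : (i <= 0)%N = false); last by lia.
rewrite (_ : (i <= k)%N); last by lia.
rewrite x0 xl !eqxx /=; apply/existsP; exists [ffun j => a (lift i j)].
apply/andP; split; apply/forallP => j.
  apply/forallP => j'; apply/implyP => le_jj; rewrite !ffunE.
  have /forallP/(_ (lift i j'))/implyP := aM (lift i j); apply.
  by rewrite /= leq_bump2.
by rewrite ffunE tnth_mktuple.
Qed.

Lemma mc_diffK k (c : MC k.+2) : mc_diff (mc_diff c) = 0.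
Proof.
rewrite [mc_diff c]/mc_diff /linext raddf_sum big1 // => y _.
rewrite raddfMz /= [X in X *~ _](_ : _ = 0) ?mul0rz //.
case: y => y memy /=.
rewrite /mc_bd raddf_sum /=.
pose ok (p q : 'I_k.+3) := [&& (0 < p < k.+2)%N, smooth p y,
  (0 < unbump p q < k.+1)%N & smooth (unbump p q) (del p y)].
pose F (p q : 'I_k.+3) : MC k :=
  (if ok p q then basis _ (del (inord (unbump p q)) (del p y)) else 0)
    *~ (-1) ^+ (p + unbump p q).
transitivity (\sum_p \sum_(q | q != p) F p q); last first.
  apply: sum_antisym => p q ne_pq.
  rewrite /F sign_unbump // mulrNz; congr (- (_ *~ _)).
  wlog lt_pq : p q ne_pq / (p < q)%N => [W|].
    have [/W->//|/W->//|/val_inj E] := ltngtP p q; first by rewrite eq_sym.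
    by rewrite E eqxx in ne_pq.
  have Epq : unbump p q = q.-1 by rewrite /unbump lt_pq subn1.
  have Eqp : unbump q p = p by rewrite /unbump ltnNge ltnW ?subn0.
  have ltp := ltn_ord p; have ltq := ltn_ord q.
  rewrite Epq Eqp.
  have -> : ok p q = ok q p.
    rewrite /ok Epq Eqp.
    have [pb|pb] := boolP (0 < p < k.+2)%N; last first.
      by symmetry; apply/negbTE; apply/negP => /and4P[]; lia.
    have [qb|qb] := boolP (0 < q < k.+2)%N; last first.
      by apply/negbTE; apply/negP => /and4P[]; lia.
    have -> : (0 < q.-1 < k.+1)%N by lia.
    have -> : (0 < p < k.+1)%N by lia.
    rewrite /= /smooth !pt_del; try lia.
    have [Eq|ne_q] := eqVneq (q : nat) p.+1.
      rewrite Eq /=.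
      have -> : bump p p.-1 = p.-1 by rewrite /bump; lia.
      have -> : bump p p = p.+1 by rewrite /bump; lia.
      have -> : bump p p.+1 = p.+2 by rewrite /bump; lia.
      have -> : bump p.+1 p.-1 = p.-1 by rewrite /bump; lia.
      have -> : bump p.+1 p = p by rewrite /bump; lia.
      have -> : bump p.+1 p.+1 = p.+2 by rewrite /bump; lia.
      have := dist_triangle (pt y p.-1) (pt y p) (pt y p.+1).
      have := dist_triangle (pt y p) (pt y p.+1) (pt y p.+2).
      have := dist_triangle (pt y p.-1) (pt y p.+1) (pt y p.+2).
      have := dist_triangle (pt y p.-1) (pt y p) (pt y p.+2).
      by lia.
    have -> : bump p q.-1.-1 = q.-1 by rewrite /bump; lia.
    have -> : bump p q.-1 = q by rewrite /bump; lia.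
    have -> : bump p q.-1.+1 = q.+1 by rewrite /bump; lia.
    have -> : bump q p.-1 = p.-1 by rewrite /bump; lia.
    have -> : bump q p = p by rewrite /bump; lia.
    have -> : bump q p.+1 = p.+1 by rewrite /bump; lia.
    by rewrite andbC.
  case: ifP => // /and4P[pb _ qb _]; congr basis.
  apply: eq_from_tnth => j; rewrite !tnth_mktuple; congr tnth.
  apply: val_inj; rewrite /= !inordK; try lia.
  by rewrite /bump; have := ltn_ord j; lia.
rewrite [LHS]big_mkcond; apply: eq_bigr => p _.
have -> : \sum_(q | q != p) F p q = \sum_(j < k.+2) F p (lift p j).
  rewrite (reindex_onto (lift p) (fun q => odflt ord0 (unlift p q))) /=.
    by apply: eq_bigl => j; rewrite liftK eqxx andbT eq_sym neq_lift.
  by move=> q; rewrite eq_sym => /unlift_some[j Ej _]; rewrite Ej liftK.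
have Fj j : F p (lift p j) =
    (if [&& (0 < p < k.+2)%N, smooth p y, (0 < j < k.+1)%N &
        smooth j (del p y)] then basis _ (del j (del p y)) else 0)
      *~ (-1) ^+ (p + j).
  by rewrite /F /ok /= bumpK inord_val.
under eq_bigr => j _ do rewrite Fj.
case: ifP => pb /=; last by rewrite big1 // => j _; rewrite mul0rz.
rewrite raddfMz /= /mc_face; case: ifP => sm /=; last first.
  by rewrite raddf0 mul0rz big1 // => j _; rewrite mul0rz.
rewrite /mc_diff linext_basis ?mc_face_closed // /mc_bd big_mkcond /=.
rewrite mulrz_suml; apply: eq_bigr => j _.
case: ifP => jb /=; last by rewrite !mul0rz.
by rewrite /mc_face -mulrzA -exprD addnC.
Qed.

Definition magnitude_complex : chain_complex :=
  @ChainComplex MC (fun k => @mc_diff k : {additive _ -> _}) mc_diffK.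

End Magnitude.

End Tree.

(** A complex on the vertex set [{1, ..., l - 1}] is a set of nonempty subsets
    of ['I_l] that do not contain [0], so that vertices keep their names. *)

Record simplicial_complex (l : nat) := SimplicialComplex {
  faces :> {set {set 'I_l}};
  faces_range : forall s, s \in faces ->
    s != set0 /\ (forall v, v \in s -> (0 < v)%N);
  faces_closed : forall s t : {set 'I_l}, s \in faces -> t \subset s -> t != set0 ->
    t \in faces
}.

Section SimplicialChains.

Variables (l : nat) (S : simplicial_complex l).

Definition SC n : zmodType :=
  freeZ {s : {set 'I_l} | (s \in S) && (#|s| == n.+1)}.

(** [enum_val] lists the elements of [s] in increasing order, by
    [enum_val_increasing] below. *)
Definition simp_bd n (s : {set 'I_l}) : SC n :=
  \sum_(i < #|s|) basis _ (s :\ enum_val i) *~ (-1) ^+ i.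

Definition simp_diff n : SC n.+1 -> SC n :=
  linext (fun s => @simp_bd n (val s)).

HB.instance Definition _ n := GRing.Additive.on (@simp_diff n).

Lemma enum_val_increasing (s : {set 'I_l}) (i j : 'I_#|s|) :
  (i < j)%N -> (enum_val i < enum_val j)%N.
Proof.
move=> lt_ij; have x0 := enum_val i; rewrite !(enum_val_nth x0).
have srt : sorted (fun u v : 'I_l => (u < v)%N) (enum s).
  rewrite /enum_mem; apply: sorted_filter; first by move=> ? ? ?; apply: ltn_trans.
  rewrite -enumT -(@map_id _ (enum _)).
  have := iota_ltn_sorted 0 l; rewrite -val_enum_ord sorted_map.
  by rewrite map_id.
apply: (@sorted_ltn_nth _ (fun u v : 'I_l => (u < v)%N)) => //.
- by move=> ? ? ?; apply: ltn_trans.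
- by rewrite inE -cardE.
- by rewrite inE -cardE.
Qed.

Lemma faces_face_closed n (s : {set 'I_l}) v :
  (s \in S) && (#|s| == n.+2) -> v \in s ->
  (s :\ v \in S) && (#|s :\ v| == n.+1).
Proof.
move=> /andP[Ss /eqP cs] sv.
have cv : #|s :\ v| = n.+1 by move: cs; rewrite (cardsD1 v) sv => -[].
rewrite cv eqxx andbT (faces_closed Ss) ?subD1set //.
by rewrite -card_gt0 cv.
Qed.

Lemma simp_bdE n (s : {set 'I_l}) :
  simp_bd n s = \sum_(v in s) basis _ (s :\ v) *~ (-1) ^+ index v (enum s).
Proof.
rewrite big_enum_val; apply: eq_bigr => i _; congr (_ *~ (-1) ^+ _).
by rewrite (enum_val_nth (enum_val i)) index_uniq ?enum_uniq // -cardE.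
Qed.

Lemma index_rem (T : eqType) (r : seq T) (v w : T) : uniq r -> v != w ->
  index v (filter (predC1 w) r) = unbump (index w r) (index v r).
Proof.
move=> Ur ne_vw; have ne_wv : w != v by rewrite eq_sym.
elim: r Ur => [|z r IHr] /= => [_|/andP[zr /IHr{IHr}IHr]]; first by [].
have [Ezw|ne_zw] /= := eqVneq z w.
  rewrite Ezw (negPf ne_wv) /unbump /= subn1 /=.
  suff -> : filter (predC1 w) r = r by [].
  apply/all_filterP/allP => u ur /=; apply: contraNneq zr => Eu.
  by rewrite Ezw -Eu.
have [Ezv|ne_zv] := eqVneq z v; first by [].
by rewrite IHr /unbump ltnS; case: ltnP => // lt_i; rewrite ?subn0 // subn1; lia.
Qed.

Lemma simp_diffK n (c : SC n.+2) : simp_diff (simp_diff c) = 0.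
Proof.
rewrite [simp_diff c]/simp_diff /linext raddf_sum big1 // => s _.
rewrite raddfMz /= [X in X *~ _](_ : _ = 0) ?mul0rz //.
case: s => s /= Ss; rewrite simp_bdE raddf_sum /=.
pose F (v w : 'I_l) : SC n :=
  (if (v \in s) && (w \in s) then basis _ (s :\ v :\ w) else 0)
    *~ (-1) ^+ (index v (enum s) + unbump (index v (enum s)) (index w (enum s))).
transitivity (\sum_v \sum_(w | w != v) F v w); last first.
  apply: sum_antisym => v w ne_vw; rewrite /F [(w \in s) && _]andbC.
  case: ifP => [/andP[sv sw]|_]; last by rewrite !mul0rz oppr0.
  rewrite sign_unbump; last first.
    by apply: contra ne_vw => /eqP/index_inj->; rewrite ?mem_enum.
  by rewrite mulrNz !setDDl setUC.
rewrite [LHS]big_mkcond; apply: eq_bigr => v _ /=.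
case: ifP => sv; last first.
  by rewrite big1 // => w _; rewrite /F sv mul0rz.
rewrite raddfMz /= /simp_diff linext_basis ?faces_face_closed //.
rewrite simp_bdE mulrz_suml [RHS](bigID (fun w => w \in s)) /=.
rewrite [X in _ = _ + X]big1.
  rewrite addr0; apply: eq_big => w; first by rewrite !inE.
  rewrite !inE => /andP[ne_wv sw]; rewrite /F sv sw -mulrzA -exprD.
  congr (_ *~ (-1) ^+ _); rewrite addnC -index_rem ?enum_uniq //.
  congr (_ + index _ _)%N; rewrite /enum_mem -filter_predI.
  by apply: eq_filter => u; rewrite /= !inE.
by move=> w /andP[_ /negPf sw]; rewrite /F sw andbF mul0rz.
Qed.

Definition simplicial_chains : chain_complex :=
  @ChainComplex SC (fun n => @simp_diff n : {additive _ -> _}) simp_diffK.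

End SimplicialChains.

Section RelativeChains.

Variables (l : nat) (S S' : simplicial_complex l).

(** The image of the chains of [S'] in those of [S], for [S'] contained in
    [S]. *)
Definition supported n : {pred SC S n} :=
  [pred c : SC S n | [forall s, (c s != 0) ==> (val s \in S')]].

Lemma supportedP n (c : SC S n) :
  reflect (forall s, c s != 0 -> val s \in S') (c \in @supported n).
Proof. exact: 'forall_implyP. Qed.

Lemma supported_zmod_closed n : zmod_closed (@supported n).
Proof.
split=> [|c d /supportedP cP /supportedP dP]; apply/supportedP => s.
  by rewrite ffunE eqxx.
rewrite !ffunE; have [c0|/cP//] := eqVneq (c s) 0.
have [d0|/dP//] := eqVneq (d s) 0.
by rewrite c0 d0 subrr eqxx.
Qed.

HB.instance Definition _ n :=
  GRing.isZmodClosed.Build (SC S n) (@supported n) (@supported_zmod_closed n).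

Lemma supported_diff n (c : SC S n.+1) :
  c \in @supported n.+1 -> simp_diff c \in @supported n.
Proof.
move=> /supportedP cP; apply: rpred_sum => s _.
have [->|/cP S's] := eqVneq (c s) 0; first by rewrite mulr0z rpred0.
apply: rpredMz; apply: rpred_sum => i _; apply: rpredMz; apply/supportedP => t.
rewrite ffunE; have [Et _|] := eqVneq (val t) _; last by rewrite mulr0n eqxx.
apply: (faces_closed S's); first by rewrite Et subD1set.
by case: (faces_range (proj1 (andP (valP t)))).
Qed.

Definition supported_complex : subcomplex (simplicial_chains S) :=
  @Subcomplex (simplicial_chains S) (fun n => @supported n : zmodClosed _)
    supported_diff.

Definition relative_chains : chain_complex := quot_complex supported_complex.

End RelativeChains.

Definition simplex_faces l : {set {set 'I_l}} :=
  [set s : {set 'I_l} | (s != set0) && [forall v in s, (0 < v)%N]].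

Lemma simplex_faces_range l (s : {set 'I_l}) : s \in simplex_faces l ->
  s != set0 /\ (forall v, v \in s -> (0 < v)%N).
Proof. by rewrite inE => /andP[-> /forall_inP]. Qed.

Lemma simplex_faces_closed l (s t : {set 'I_l}) : s \in simplex_faces l ->
  t \subset s -> t != set0 -> t \in simplex_faces l.
Proof.
rewrite !inE => /andP[_ /forall_inP sP] /subsetP ts -> /=.
by apply/forall_inP => v /ts/sP.
Qed.

Definition Delta l : simplicial_complex l :=
  SimplicialComplex (@simplex_faces_range l) (@simplex_faces_closed l).

Section DeltaPath.

Variables (G : tree) (l : nat) (x : l.+1.-tuple G).

Definition turns : {set 'I_l} :=
  [set i : 'I_l | (0 < i)%N &&
    (dist (pt x i.-1) (pt x i.+1) <
       dist (pt x i.-1) (pt x i) + dist (pt x i) (pt x i.+1))%N].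

Definition Delta_path_faces : {set {set 'I_l}} :=
  [set s : {set 'I_l} | (s \in Delta l) && ~~ (turns \subset s)].

Lemma Delta_path_faces_range (s : {set 'I_l}) : s \in Delta_path_faces ->
  s != set0 /\ (forall v, v \in s -> (0 < v)%N).
Proof. by rewrite inE => /andP[/faces_range]. Qed.

Lemma Delta_path_faces_closed (s t : {set 'I_l}) : s \in Delta_path_faces ->
  t \subset s -> t != set0 -> t \in Delta_path_faces.
Proof.
rewrite ![_ \in Delta_path_faces]inE => /andP[Ds ns] ts t0; apply/andP; split.
  exact: (faces_closed Ds).
by apply: contra ns => /subset_trans; apply.
Qed.

Definition Delta_path : simplicial_complex l :=
  SimplicialComplex Delta_path_faces_range Delta_path_faces_closed.

End DeltaPath.

(* Main.v *)
Require Import Defs.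
From HB Require Import structures.
From mathcomp Require Import all_boot all_algebra zify.

(** A generator [y] of the magnitude complex samples [x] at the
    times [d(y_0,y_1) + ... + d(y_{j-1},y_j)]; since the total length is [l], these
    are the only possible times, and all pieces of [x] between them are
    geodesic.  In a tree a walk is geodesic exactly when it has no turn, so the
    sets of interior times are the subsets of [{1, ..., l-1}] containing all
    turns, i.e. the simplices that survive in the relative complex.  Removing
    [y_{j+1}] is removing the [j]-th time, which shifts the sign by one; the face
    is zero on either side exactly when a turn is removed. *)

Set Implicit Arguments.
Unset Strict Implicit.
Unset Printing Implicit Defensive.

Import GRing.Theory.

Lemma tnth_pt (G : tree) k (y : k.+1.-tuple G) (j : 'I_k.+1) :
  tnth y j = pt y j.
Proof. by rewrite /pt inord_val. Qed.

(** * Geodesics in a tree *)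

Section TreeGeodesics.

Variable G : tree.
Implicit Types u v w : G.

Definition avoid u : rel G := [rel a b | [&& adj a b, a != u & b != u]].

Lemma avoid_connect_sym u : connect_sym (avoid u).
Proof.
apply: sym_connect_sym => a b; rewrite /avoid /= adj_sym.
by rewrite [(a != u) && _]andbC.
Qed.

(** A geodesic from [w] to [v] through [u] would continue past [u], so [u] would be strictly closer
    to [w] than [v] is. *)
Lemma avoid_connect u v w : u != v -> dist w v <= dist w u ->
  connect (avoid u) w v.
Proof.
move=> ne_uv le_vu; have [p [pP lp sp]] := dist_walk w v.
have up : u \notin w :: p.
  apply: contra ne_uv => /splitPl Hp; move: Hp pP lp sp => [p1 p2 l1].
  rewrite cat_path last_cat size_cat l1 => /andP[p1P _].
  have := dist_le p1P; rewrite l1 => le1.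
  by case: p2 => [/= -> //|a p2 _ sz] //=; move: sz => /=; lia.
apply/connectP; exists p => //.
elim: p w pP up {le_vu lp sp} => //= a p IHp w /andP[wa pP].
rewrite !inE !negb_or => /and3P[uw ua up].
by rewrite IHp ?inE ?negb_or ?ua // andbT /avoid /= wa ![_ == u]eq_sym uw ua.
Qed.

(** Both neighbours are joined to [w], hence to each other, by walks avoiding [u]. If they differed,
    a simple path between them would close up through [u] to a cycle. *)
Lemma closer_neighbour_unique u v v' w : adj u v -> adj u v' ->
  dist w v <= dist w u -> dist w v' <= dist w u -> v = v'.
Proof.
move=> uv uv' dv dv'; apply/eqP; apply/negPn/negP => ne_v.
have neq_adj a : adj u a -> u != a.
  by apply: contraTneq => ->; rewrite adj_irr.
have : connect (avoid u) v v'.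
  apply: (connect_trans (y := w)); last by rewrite avoid_connect ?neq_adj.
  by rewrite avoid_connect_sym avoid_connect ?neq_adj.
case/connectP => p0 p0P; case/shortenP: p0P => p pP Up _ lp.
have up : u \notin v :: p.
  rewrite inE negb_or neq_adj //=; elim: p v pP {Up lp ne_v uv dv} => //= a p IHp b.
  case/andP=> /and3P[_ _ nau] /IHp.
  by rewrite inE negb_or eq_sym nau.
have pA : path (adj (t:=G)) v p.
  by apply: sub_path pP => a b /and3P[].
(* Acyclicity bounds the cycle [u, v, p] by two vertices, so [p] is empty and [v] equals its
   endpoint [v']. *)
have := @tree_acyclic G [:: u, v & p].
rewrite cons_uniq up Up /= uv rcons_path pA /= -lp adj_sym uv' => /(_ isT isT).
by case: p lp {pP Up up pA} => // lp; rewrite lp eqxx in ne_v.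
Qed.

Lemma dist1_adj u v : dist u v = 1%N -> adj u v.
Proof.
have [[|a [|b p]] [pP lp sp]] := dist_walk u v; rewrite -sp //= => _.
by move: pP lp; rewrite /= andbT => ? <-.
Qed.

End TreeGeodesics.

(** * Turns and geodesic stretches of the path *)

Section VisitTimes.

Variables (G : tree) (l : nat) (x : l.+1.-tuple G).
Hypothesis xP : is_path x.

Lemma path_adj i : i < l -> dist (pt x i) (pt x i.+1) = 1%N.
Proof. by move=> lt_il; case/andP: xP => _ /forallP/(_ (Ordinal lt_il))/eqP. Qed.

Lemma turnsP (i : 'I_l) :
  (i \in turns x) = (0 < i) && (dist (pt x i.-1) (pt x i.+1) < 2).
Proof.
rewrite inE; case: (posnP i) => //= i0.
have := @path_adj i.-1; rewrite prednK // => ->; last by have := ltn_ord i; lia.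
by rewrite path_adj.
Qed.

(** Extend a geodesic stretch from [j] to [j.+1]. If the distance from [x_i] does not grow, then
    [x_{j-1}] and [x_{j+1}] are both neighbours of [x_j] no farther from [x_i] than [x_j]; they
    coincide, and [j] is a turn. *)
Lemma geodesic_without_turns i j : i <= j <= l ->
  (forall m : 'I_l, i < m < j -> m \notin turns x) ->
  dist (pt x i) (pt x j) = j - i.
Proof.
elim/ltn_ind: j => -[|j] IHj /andP[le_ij le_jl] noturn.
  by move: le_ij; rewrite leqn0 => /eqP->; rewrite distuu.
have [->|ne_ij] := eqVneq i j.+1; first by rewrite distuu subnn.
have le_ij' : i <= j by lia.
have noturn' m' : m' <= j.+1 -> forall m : 'I_l, i < m < m' -> m \notin turns x.
  by move=> le_m' m lt_m; apply: noturn; lia.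
have Dj : dist (pt x i) (pt x j) = j - i.
  by apply: IHj; [lia | lia | apply: noturn'].
have [Eij|ne_ij'] := eqVneq i j.
  by rewrite Eij path_adj ?subSnn //; lia.
have Dj' : dist (pt x i) (pt x j.-1) = j.-1 - i.
  by apply: IHj; [lia | lia | apply: noturn'; lia].
have ub : dist (pt x i) (pt x j.+1) <= j.+1 - i.
  by apply: sum_dist_ge => //; lia.
apply/eqP; rewrite eqn_leq ub /= leqNgt; apply/negP => lt_d.
have lt_jl : j < l by lia.
suff: Ordinal lt_jl \in turns x by apply/negP; apply: noturn => /=; lia.
rewrite turnsP /=; apply/andP; split; first by lia.
suff -> : pt x j.-1 = pt x j.+1 by rewrite distuu.
have aj : adj (pt x j) (pt x j.-1).
  rewrite adj_sym; apply: dist1_adj.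
  by have := @path_adj j.-1; rewrite prednK; [apply; lia | lia].
apply: (closer_neighbour_unique (w := pt x i) aj).
- by apply: dist1_adj; rewrite path_adj.
- by lia.
- by rewrite Dj; lia.
Qed.

(** * Partial lengths of a tuple as visit times *)

Definition partial_len k (y : k.+1.-tuple G) (j : nat) : nat :=
  \sum_(t < j) dist (pt y t) (pt y t.+1).

Lemma partial_lenS k (y : k.+1.-tuple G) j :
  partial_len y j.+1 = partial_len y j + dist (pt y j) (pt y j.+1).
Proof. by rewrite /partial_len big_ord_recr. Qed.

Lemma partial_len_le k (y : k.+1.-tuple G) i j :
  i <= j -> partial_len y i <= partial_len y j.
Proof.
move/subnKC <-; elim: (j - i) => [|d IHd]; first by rewrite addn0.
by rewrite addnS partial_lenS; apply: leq_trans IHd (leq_addr _ _).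
Qed.

(* The bounds [dist <= T j.+1 - T j] add up to at most [l], so all of them are
   attained. *)
Lemma partial_len_unique k (y : k.+1.-tuple G) (T : nat -> nat) :
    (forall j, j < k -> T j <= T j.+1) -> T k <= l ->
    (forall j, j <= k -> pt y j = pt x (T j)) -> len y = l ->
  forall j, j <= k -> partial_len y j = T j.
Proof.
move=> TS Tk yT ly.
have mono i j : i <= j <= k -> T i <= T j.
  elim: j => [|j IHj]; first by rewrite leqn0 => /andP[/eqP->].
  have [-> //|ne_ij] := eqVneq i j.+1 => H.
  by apply: leq_trans (TS j _); [apply: IHj | ]; lia.
have step j : j < k -> dist (pt y j) (pt y j.+1) <= T j.+1 - T j.
  move=> lt_jk; rewrite !yT ?(ltnW lt_jk) //; apply: sum_dist_ge => //.
  by rewrite TS //= (leq_trans (mono j.+1 k _)) // lt_jk leqnn.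
have diff_le i j : i <= j <= k -> partial_len y j - partial_len y i <= T j - T i.
  elim: j => [|j IHj]; first by rewrite leqn0 => /andP[/eqP->]; rewrite subnn.
  have [->|ne_ij] := eqVneq i j.+1 => H; first by rewrite !subnn.
  have := IHj; have := step j; have := TS j; have := mono i j.
  by rewrite partial_lenS; lia.
move=> j le_jk; have := diff_le 0 j; have := diff_le j k.
have := mono j k; have := mono 0 j.
have -> : partial_len y k = l by [].
have -> : partial_len y 0 = 0 by rewrite /partial_len big_ord0.
by rewrite le_jk leqnn /=; lia.
Qed.

(** Minimality follows from the length: a path passing through [y] has length at least [len y],
    which is [l]. *)
Lemma mc_memE k (y : k.+1.-tuple G) :
  mc_mem x y = [&& consecutive_distinct y, len y == l & passes x y].
Proof.
rewrite /mc_mem /is_path_of; case: consecutive_distinct => //=.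
case: eqP => //= ly; case: passes => //=; apply/forallP => m; apply/forallP => q.
by apply/negP => /passes_len; rewrite ly leqNgt ltn_ord.
Qed.

(** The times [a] provided by [passes] are monotone and at most [l], so [partial_len_unique] forces
    them to be the partial lengths. *)
Lemma mc_mem_visit k (y : k.+1.-tuple G) : mc_mem x y ->
  forall j, j <= k -> pt y j = pt x (partial_len y j).
Proof.
rewrite mc_memE => /and3P[_ /eqP ly /and4P[_ _ _]].
case/existsP=> a /andP[/forallP aM /forallP aE].
have yT j : j <= k -> pt y j = pt x (a (inord j)).
  by move=> _; rewrite /pt inord_val -(eqP (aE _)).
move=> j le_jk; rewrite (partial_len_unique (T := fun j => a (inord j))) //.
- exact: yT.
- move=> i lt_ik; have /forallP/(_ (inord i.+1))/implyP := aM (inord i); apply.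
  by rewrite !inordK; lia.
- by rewrite -ltnS ltn_ord.
Qed.

Lemma mc_mem_partial_len_lt k (y : k.+1.-tuple G) : mc_mem x y ->
  forall j, j < k -> partial_len y j < partial_len y j.+1.
Proof.
case/and3P=> /forallP nd _ _ j lt_jk; rewrite partial_lenS -ltn_subLR // subnn.
rewrite lt0n; apply: contraNneq (nd (Ordinal lt_jk)) => /dist_eq0 E.
exact/eqP.
Qed.

Lemma mc_mem_len k (y : k.+1.-tuple G) : mc_mem x y -> partial_len y k = l.
Proof. by case/and3P=> _ /eqP. Qed.

(** * From generators to sets of interior times *)

Definition interior_times k (y : k.+1.-tuple G) : seq nat :=
  [seq partial_len y j | j <- iota 1 k.-1].

Definition visit_set k (y : k.+1.-tuple G) : {set 'I_l} :=
  [set i : 'I_l | (i : nat) \in interior_times y].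

(* [time s j] is the [j]-th element of [{0} \cup s \cup {l}]; the default value
   of [nth] provides the last one. *)
Definition time (s : {set 'I_l}) (j : nat) : nat :=
  nth l (0 :: map val (enum s)) j.

Definition visit_tuple n (s : {set 'I_l}) : n.+3.-tuple G :=
  [tuple pt x (time s j) | j < n.+3].

Lemma pt_visit_tuple n s j : j <= n.+2 -> pt (visit_tuple n s) j = pt x (time s j).
Proof. by move=> le_jn; rewrite /pt tnth_mktuple inordK. Qed.

Lemma sorted_enum (s : {set 'I_l}) : sorted ltn (map val (enum s)).
Proof.
rewrite sorted_map /enum_mem.
apply: sorted_filter => [a b c|]; first exact: ltn_trans.
have := iota_ltn_sorted 0 l; rewrite -val_enum_ord sorted_map.
by rewrite enumT.
Qed.

(** Both lists are strictly increasing with the same members. Thus the enumeration of the set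
    recovers the order of the tuple. *)
Lemma enum_visit_set k (y : k.+1.-tuple G) : mc_mem x y ->
  map val (enum (visit_set y)) = interior_times y.
Proof.
move=> yP; have incr := mc_mem_partial_len_lt yP.
have mono i j : i < j <= k -> partial_len y i < partial_len y j.
  elim: j => // j IHj H; have [->|ne_ij] := eqVneq i j; first by apply: incr; lia.
  by apply: (ltn_trans (IHj _)); [lia | apply: incr; lia].
apply: (irr_sorted_eq ltn_trans ltnn); first exact: sorted_enum.
  rewrite sorted_map.
  apply: (@sub_in_sorted _ (fun j => j <= k.-1) ltn); last 2 first.
  - by apply/allP => j; rewrite mem_iota; lia.
  - exact: iota_ltn_sorted.
  by move=> i j /=; rewrite !unfold_in => Hi Hj lt_ij; apply: mono; lia.
move=> i; apply/mapP/idP => [[j]|iP]; first by rewrite mem_enum inE => ? ->.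
have lt_il : i < l.
  case/mapP: iP => j; rewrite mem_iota => jP ->.
  by rewrite -(mc_mem_len yP); apply: mono; lia.
by exists (Ordinal lt_il) => //; rewrite mem_enum inE.
Qed.

Lemma time_visit_set k (y : k.+1.-tuple G) j : 0 < k -> mc_mem x y -> j <= k ->
  time (visit_set y) j = partial_len y j.
Proof.
move=> k0 yP le_jk; rewrite /time enum_visit_set //.
case: j le_jk => [|j] le_jk; first by rewrite /partial_len big_ord0.
have [->|ne_jk] := eqVneq j.+1 k; last first.
  by rewrite /= (nth_map 0) ?size_iota ?nth_iota ?add1n //; lia.
(* With the leading [0] the list has [k] entries, so index [k] yields the default [l], which is the
   total length. *)
rewrite nth_default ?mc_mem_len //= size_map size_iota; lia.
Qed.

Lemma card_visit_set k (y : k.+1.-tuple G) : mc_mem x y -> #|visit_set y| = k.-1.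
Proof.
by move=> yP; rewrite cardE -(size_map val) enum_visit_set // size_map size_iota.
Qed.

Lemma visit_tupleK n (y : n.+3.-tuple G) : mc_mem x y ->
  visit_tuple n (visit_set y) = y.
Proof.
move=> yP; apply: eq_from_tnth => j; rewrite !tnth_pt.
have le_j : j <= n.+2 by rewrite -ltnS.
by rewrite pt_visit_tuple // time_visit_set // -mc_mem_visit.
Qed.

Lemma visit_set_pos k (y : k.+1.-tuple G) v :
  mc_mem x y -> v \in visit_set y -> 0 < v.
Proof.
move=> yP; rewrite inE => /mapP[j]; rewrite mem_iota => jP ->.
by case: j jP => // j jP; apply: leq_ltn_trans (mc_mem_partial_len_lt yP _); lia.
Qed.

Lemma visit_set_Delta n (y : n.+3.-tuple G) : mc_mem x y -> visit_set y \in Delta l.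
Proof.
move=> yP; rewrite inE -card_gt0 card_visit_set //=.
by apply/forall_inP => v; apply: visit_set_pos.
Qed.

(** A turn strictly between two consecutive visit times would give a shortcut, making their distance
    smaller than the elapsed time. *)
Lemma turns_visit_set k (y : k.+1.-tuple G) : mc_mem x y ->
  turns x \subset visit_set y.
Proof.
move=> yP; apply/subsetP => i; rewrite turnsP => /andP[i0 lt2].
(* Locates the pair of consecutive visit times around [i]. *)
have brk m : i < partial_len y m ->
    exists j, j < m /\ partial_len y j <= i < partial_len y j.+1.
  elim: m => [|m IHm]; first by rewrite /partial_len big_ord0.
  case: (ltnP i (partial_len y m)) => [/IHm[j [lt_jm jP]] _|le_i lt_i].
    by exists j; split=> //; apply: ltnW.
  by exists m; rewrite le_i.
have [|j [lt_jk /andP[le_ji lt_ij]]] := brk k.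
  by rewrite mc_mem_len.
have [Ej|ne_ji] := eqVneq (partial_len y j) i.
  rewrite inE -Ej map_f // mem_iota.
  by case: j {le_ji lt_ij} lt_jk Ej => [|j]; [rewrite /partial_len big_ord0|]; lia.
have le_l : partial_len y j.+1 <= l.
  by rewrite -(mc_mem_len yP) partial_len_le.
have := partial_lenS y j.
rewrite (mc_mem_visit yP (ltnW lt_jk)) (mc_mem_visit yP lt_jk).
set a := partial_len y j in le_ji ne_ji *.
set b := partial_len y j.+1 in le_l lt_ij *.
(* Going through [i.-1] and [i.+1], which are at distance at most 1, bounds the distance by
   [b - a - 1], whereas it equals [b - a]. *)
have := dist_triangle (pt x a) (pt x i.-1) (pt x b).
have := dist_triangle (pt x i.-1) (pt x i.+1) (pt x b).
have := @sum_dist_ge _ _ x a i.-1 xP; have := @sum_dist_ge _ _ x i.+1 b xP.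
by lia.
Qed.

(** * From sets of interior times back to tuples *)

Section SetToTuple.

Variables (n : nat) (s : {set 'I_l}).
Hypotheses (sD : s \in Delta l) (cs : #|s| = n.+1).

Lemma time_last : time s n.+2 = l.
Proof. by rewrite /time nth_default //= size_map -cardE cs. Qed.

Lemma time_mem j : j < n.+1 -> exists2 v, v \in s & time s j.+1 = v.
Proof.
move=> lt_jn; have lt_j : j < size (enum s) by rewrite -cardE cs.
have x0 : 'I_l by case: (enum s) lt_j.
exists (nth x0 (enum s) j); first by rewrite -mem_enum mem_nth.
by rewrite /time /= (nth_map x0).
Qed.

(** Strictness at the two ends comes from the range of the vertices: they are positive and below
    [l]. *)
Lemma time_lt j : j < n.+2 -> time s j < time s j.+1.
Proof.
move=> lt_jn; have [Ej|ne_j] := eqVneq j n.+1.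
  rewrite Ej time_last; have [|v _ ->] := @time_mem n; last by [].
  exact: leqnn.
case: j lt_jn ne_j => [|j] lt_jn ne_j.
  have [|v vs ->] := @time_mem 0; first by [].
  by case: (faces_range sD) => _; apply.
have /(sorted_ltn_nth ltn_trans l) H := sorted_enum s.
by apply: (H j j.+1); rewrite // inE size_map -cardE cs; lia.
Qed.

Lemma time_le_l j : j <= n.+2 -> time s j <= l.
Proof.
move=> le_jn; rewrite -time_last -(subKn le_jn).
elim: (n.+2 - j) (leq_subr j n.+2) => [|m IHm] le_m; first by rewrite subn0.
apply: leq_trans (IHm (ltnW le_m)); apply: ltnW.
by have := @time_lt (n.+2 - m.+1); rewrite -subSn // subSS; apply; lia.
Qed.

Lemma interior_times_time :
  [seq time s j | j <- iota 1 n.+1] = map val (enum s).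
Proof.
apply: (@eq_from_nth _ l) => [|i]; first by rewrite !size_map size_iota -cardE cs.
rewrite size_map size_iota => lt_in.
by rewrite (nth_map 0) ?size_iota // nth_iota.
Qed.

(** Length [l] lets [partial_len_unique] identify the partial lengths with the times of [s]. A
    hypothesis on the length suits faces obtained from [del], whose length is known from
    [len_del]. *)
Lemma visit_setK : len (visit_tuple n s) = l -> visit_set (visit_tuple n s) = s.
Proof.
move=> ly; apply/setP => i; rewrite inE.
have -> : interior_times (visit_tuple n s) = map val (enum s).
  rewrite -interior_times_time; apply/eq_in_map => j; rewrite mem_iota => jP.
  apply: partial_len_unique => //.
  - by move=> t /time_lt/ltnW.
  - by rewrite time_last.
  - by move=> t; apply: pt_visit_tuple.
  - by lia.
by rewrite mem_map ?mem_enum //; apply: val_inj.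
Qed.

Hypothesis ts : turns x \subset s.

Lemma dist_time j : j < n.+2 ->
  dist (pt x (time s j)) (pt x (time s j.+1)) = time s j.+1 - time s j.
Proof.
move=> lt_jn; apply: geodesic_without_turns.
  by rewrite time_le_l // ltnW // time_lt.
move=> m /andP[lt_m m_lt]; apply/negP => /(subsetP ts) ms.
(* A turn inside the stretch lies in [s], so it is itself a time, strictly between two consecutive
   ones: impossible by monotonicity. *)
have [i lt_i Ei] : exists2 i, i < n.+1 & time s i.+1 = m.
  have lt_i : index m (enum s) < size (enum s) by rewrite index_mem mem_enum.
  exists (index m (enum s)); first by rewrite -cs cardE.
  by rewrite /time /= (nth_map m) // nth_index // mem_enum.
have mono a b : a <= b <= n.+2 -> time s a <= time s b.
  elim: b => [|b IHb]; first by rewrite leqn0 => /andP[/eqP->].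
  have [-> //|ne_ab] := eqVneq a b.+1 => H.
  by apply: leq_trans (ltnW (time_lt _)); [apply: IHb|]; lia.
by have := mono i.+1 j; have := mono j.+1 i.+1; rewrite Ei; lia.
Qed.

(** All stretches are geodesic, so the partial lengths are the times of [s]; these also serve as the
    monotone visit function required by [passes]. *)
Lemma mc_mem_visit_tuple : mc_mem x (visit_tuple n s).
Proof.
have yT j : j <= n.+2 -> pt (visit_tuple n s) j = pt x (time s j).
  exact: pt_visit_tuple.
have pl j : j <= n.+2 -> partial_len (visit_tuple n s) j = time s j.
  elim: j => [|j IHj] lt_jn; first by rewrite /partial_len big_ord0.
  rewrite partial_lenS IHj ?(ltnW lt_jn) // !yT ?(ltnW lt_jn) // dist_time //.
  by rewrite subnKC // ltnW // time_lt.
rewrite mc_memE; apply/and3P; split.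
- apply/forallP => j; have lt_j := ltn_ord j; apply/eqP.
  rewrite !yT ?(ltnW lt_j) // => E; have := dist_time lt_j; have := time_lt lt_j.
  by rewrite E distuu; lia.
- by apply/eqP; rewrite -[LHS]/(partial_len _ n.+2) pl // time_last.
apply/and4P; split=> //; first by rewrite yT.
  by rewrite yT // time_last.
apply/existsP; exists [ffun j : 'I_n.+3 => inord (time s j)].
have le_tl (j : 'I_n.+3) : time s j < l.+1.
  by rewrite ltnS time_le_l // -ltnS.
apply/andP; split; apply/forallP => i; last first.
  by rewrite !ffunE tnth_mktuple.
apply/forallP => j; apply/implyP => le_ij; rewrite !ffunE !inordK //.
by rewrite -!pl ?leq_ord // partial_len_le.
Qed.

End SetToTuple.

End VisitTimes.

(** * Removing a vertex versus removing an entry *)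

Lemma nth_filter_predC1 (T : eqType) (S : Type) (x0 : T) (d : S) (f : T -> S)
    (r : seq T) j i : uniq r -> j < size r ->
  nth d (map f (filter (predC1 (nth x0 r j)) r)) i = nth d (map f r) (bump j i).
Proof.
elim: r j i => // z r IHr [|j] i /= /andP[zr Ur] lt_j.
  rewrite eqxx /=; congr (nth d (map f _) i); apply/all_filterP/allP => u ur /=.
  by apply: contraNneq zr => <-.
have -> /= : z != nth x0 r j by apply: contraNneq zr => ->; apply: mem_nth.
by case: i => [|i] //=; rewrite bumpS /= IHr.
Qed.

(** The shift to [j.+1] accounts for the initial time [0], which precedes the elements of [s]. *)
Lemma time_setD1 l (s : {set 'I_l}) (j : 'I_#|s|) i :
  time (s :\ enum_val j) i = time s (bump j.+1 i).
Proof.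
rewrite /time; case: i => [|i] //; rewrite bumpS /=.
have lt_j : j < size (enum s) by rewrite -cardE.
rewrite -(nth_filter_predC1 (enum_val j)) ?enum_uniq // -enum_val_nth.
congr (nth l (map val _) i); rewrite /enum_mem -filter_predI.
by apply: eq_filter => u; rewrite /= !inE.
Qed.

(** An equality of tuples only: it holds whether or not the corresponding face vanishes. *)
Lemma visit_tuple_setD1 (G : tree) l (x : l.+1.-tuple G) n (y : n.+4.-tuple G)
    (j : 'I_#|visit_set l y|) : is_path x -> mc_mem x y ->
  visit_tuple x n (visit_set l y :\ enum_val j) = del (inord j.+1) y.
Proof.
move=> xP yP; have lt_j : j < n.+2
  by apply: leq_trans (ltn_ord j) _; rewrite (card_visit_set xP yP).
have le_b (i : 'I_n.+3) : bump j.+1 i <= n.+3.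
  by have := leq_ord i; rewrite /bump; lia.
apply: eq_from_tnth => i; rewrite !tnth_pt pt_del ?leq_ord //.
rewrite pt_visit_tuple ?leq_ord // time_setD1 (time_visit_set xP) //.
by rewrite inordK; [rewrite (mc_mem_visit xP yP) | lia].
Qed.

(** * Additive maps out of free modules *)

Section FreeModules.

Local Open Scope ring_scope.

Variables (T : eqType) (P : pred T) (S : subFinType P).

Lemma freeZ_sum_basis (c : freeZ S) : c = \sum_s basis S (val s) *~ c s.
Proof.
apply/ffunP => s; rewrite sum_ffunE (bigD1 s) //= big1 => [|t ne_ts].
  by rewrite addr0 ffunMzE ffunE eqxx; apply/esym/intz.
by rewrite ffunMzE ffunE val_eqE eq_sym (negPf ne_ts) mul0rz.
Qed.

Lemma additive_basis_ext (M : zmodType) (f g : {additive freeZ S -> M}) :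
  (forall s : S, f (basis S (val s)) = g (basis S (val s))) -> f =1 g.
Proof.
move=> fg c; rewrite [c]freeZ_sum_basis !raddf_sum.
by apply: eq_bigr => s _; rewrite !raddfMz /= fg.
Qed.

End FreeModules.

(** * The chain isomorphism *)

Section ChainIsomorphism.

Local Open Scope ring_scope.
Local Open Scope quotient_scope.

Variables (G : tree) (l : nat) (x : l.+1.-tuple G).
Hypothesis xP : is_path x.

Notation RC n := (quot_chain (supported_complex (Delta l) (Delta_path x)) n).
Notation simplex n := {t : {set 'I_l} | (t \in Delta l) && (#|t| == n.+1)}.
Notation generator k := {z : k.+1.-tuple G | mc_mem x z}.
Notation sbasis n s := (basis (simplex n) s).
Notation ybasis k y := (basis (generator k) y).

Lemma pi_basis_eq0 n (s : {set 'I_l}) : ~~ (turns x \subset s) ->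
  \pi_(RC n) (sbasis n s) = 0.
Proof.
move=> nts; rewrite -(raddf0 (\pi_(RC n))); apply/eqP.
rewrite -Quotient.idealrBE subr0; apply/supportedP => t.
rewrite ffunE; have [Et _|] := eqVneq (val t) s; last by rewrite mulr0n eqxx.
by rewrite inE Et nts andbT -Et; case/andP: (valP t).
Qed.

Definition to_relative n : MC x n.+2 -> RC n :=
  linext (fun y : generator n.+2 => \pi_(RC n) (sbasis n (visit_set l (val y)))).

HB.instance Definition _ n := GRing.Additive.on (@to_relative n).

Lemma to_relative_basis n (y : n.+3.-tuple G) : mc_mem x y ->
  to_relative (ybasis n.+2 y) = \pi_(RC n) (sbasis n (visit_set l y)).
Proof.
exact: (linext_basis _ (fun y : n.+3.-tuple G =>
  \pi_(RC n) (sbasis n (visit_set l y)))).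
Qed.

(** The value [0] on simplices missing a turn makes this map vanish on the chains of [Delta_path x],
    so that it descends to the quotient. *)
Definition of_simplices n : SC (Delta l) n -> MC x n.+2 :=
  linext (fun s : simplex n => if turns x \subset val s
    then ybasis n.+2 (visit_tuple x n (val s)) else 0).

HB.instance Definition _ n := GRing.Additive.on (@of_simplices n).

Lemma of_simplices_basis n (s : {set 'I_l}) :
    (s \in Delta l) && (#|s| == n.+1) ->
  of_simplices (sbasis n s) =
    if turns x \subset s then ybasis n.+2 (visit_tuple x n s) else 0.
Proof.
exact: (linext_basis _ (fun s : {set 'I_l} =>
  if turns x \subset s then ybasis n.+2 (visit_tuple x n s) else 0)).
Qed.

Lemma of_simplices_supported n (c : SC (Delta l) n) :
  c \in supported (Delta_path x) (n := n) -> of_simplices c = 0.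
Proof.
move/supportedP=> cP; apply: big1 => s _.
have [->|/cP] := eqVneq (c s) 0; first exact: mulr0z.
by rewrite inE => /andP[_ /negPf->]; rewrite mul0rz.
Qed.

Definition of_relative n (q : RC n) : MC x n.+2 := of_simplices (repr q).

Lemma of_relative_pi n (c : SC (Delta l) n) :
  of_relative (\pi_(RC n) c) = of_simplices c.
Proof.
apply/eqP; rewrite /of_relative -subr_eq0 -raddfB /=.
apply/eqP; apply: of_simplices_supported.
rewrite -[_ \in _]/(_ \in supported_complex (Delta l) (Delta_path x) n).
by rewrite Quotient.idealrBE reprK.
Qed.

Lemma to_relativeK n : cancel (@to_relative n) (@of_relative n).
Proof.
move=> c.
have -> : to_relative c =
    \pi_(RC n) (\sum_y sbasis n (visit_set l (val y)) *~ c y).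
  by rewrite raddf_sum; apply: eq_bigr => y _; rewrite raddfMz.
rewrite of_relative_pi [RHS]freeZ_sum_basis raddf_sum; apply: eq_bigr => y _.
have yP := valP y; rewrite raddfMz /= of_simplices_basis; last first.
  by rewrite (visit_set_Delta xP) // (card_visit_set xP) /=.
by rewrite (turns_visit_set xP yP) visit_tupleK.
Qed.

(** It suffices to compare on basis simplices: one containing all turns is recovered by
    [visit_setK], any other has class zero. *)
Lemma of_relativeK n : cancel (@of_relative n) (@to_relative n).
Proof.
move=> q; rewrite -[in RHS](reprK q) /of_relative.
move: (repr q); apply: (additive_basis_ext
  (f := @to_relative n \o @of_simplices n) (g := \pi_(RC n))) => s.
have /andP[sD /eqP cs] := valP s.
rewrite -[LHS]/(to_relative (of_simplices (sbasis n (val s)))).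
rewrite -[RHS]/(\pi_(RC n) (sbasis n (val s))).
rewrite of_simplices_basis; last by rewrite sD cs /=.
case: ifP => [ts|/negbT nts]; last first.
  by rewrite raddf0 pi_basis_eq0.
have yP := mc_mem_visit_tuple xP sD cs ts.
by rewrite to_relative_basis // visit_setK //; case/and3P: yP => _ /eqP.
Qed.

(** If the entry is smooth, deleting it gives a generator with the smaller visit set. If not, that
    set misses a turn and both sides are zero. *)
Lemma to_relative_face n (y : n.+4.-tuple G) (j : 'I_#|visit_set l y|) :
    mc_mem x y ->
  to_relative (mc_face x (inord j.+1) y) =
    \pi_(RC n) (sbasis n (visit_set l y :\ enum_val j)).
Proof.
move=> yP; have sE := visit_tuple_setD1 j xP yP.
set s := _ :\ _ in sE *.
have lt_j : (j < n.+2)%N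
  by apply: leq_trans (ltn_ord j) _; rewrite (card_visit_set xP yP).
have jP : (0 < (inord j.+1 : 'I_n.+4) < n.+3)%N by rewrite inordK //; lia.
have /andP[sD /eqP cs] : (s \in Delta l) && (#|s| == n.+1).
  rewrite faces_face_closed ?enum_valP // (visit_set_Delta xP) //.
  by rewrite (card_visit_set xP) /=.
have ly : len y = l by case/and3P: yP => _ /eqP.
rewrite /mc_face; case: ifPn => [sm|/negP nsm].
  have dP := mc_face_closed jP sm yP.
  by rewrite to_relative_basis // -sE visit_setK // sE len_del.
rewrite raddf0 pi_basis_eq0 //; apply/negP => ts; apply: nsm.
(* If no turn were missing, the stretch of [s] skipping the removed time would be geodesic from
   [partial_len y j] to [partial_len y j.+2], which is smoothness at [j.+1]. *)
have := dist_time xP sD cs ts lt_j.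
rewrite !time_setD1 /bump ltnn leqnn add0n add1n !(time_visit_set xP) //; try lia.
rewrite -!(mc_mem_visit xP yP) //; try lia.
rewrite !partial_lenS /smooth inordK /=; last by rewrite ltnS ltnW.
by move=> ->; rewrite -addnA addKn.
Qed.

Lemma to_relative_diff n (c : MC x n.+3) :
  to_relative (mc_diff c) =
    - quot_diff (to_relative c).
Proof.
move: c; apply: (additive_basis_ext
  (f := @to_relative n \o @mc_diff G l x n.+2)
  (g := \- (@quot_diff _ (supported_complex (Delta l) (Delta_path x)) n
             \o @to_relative n.+1))) => y.
rewrite -[LHS]/(to_relative (mc_diff (ybasis n.+3 (val y)))).
rewrite -[RHS]/(- quot_diff (to_relative (ybasis n.+3 (val y)))).
move: (val y) (valP y) => {}y yP.
have cs : #|visit_set l y| = n.+2 := card_visit_set xP yP.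
rewrite /mc_diff linext_basis // to_relative_basis // quot_diffE.
rewrite [diff _ _ _]/(simp_diff _) /simp_diff linext_basis; last first.
  by rewrite (visit_set_Delta xP yP) cs /=.
(* Splitting off the end indices [0] and [n.+3], which contribute nothing, leaves one face for each
   of the [n.+2] vertices. *)
rewrite /mc_bd /simp_bd !raddf_sum big_mkcond big_ord_recl big_ord_recr /=.
rewrite ltnn add0r addr0.
(* The sign is that of vertex [i], while the face has index [i.+1]; the discrepancy is the minus
   sign of [opp_diff]. *)
pose F i := to_relative (mc_face x (inord i.+1) y) *~ (-1) ^+ i.
transitivity (\sum_(i < n.+2) - F i).
  apply: eq_bigr => i _; have lt_i := ltn_ord i.
  rewrite ifT; last by rewrite /bump /=; lia.
  have -> : lift ord0 (widen_ord (leqnSn n.+2) i) = inord i.+1.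
    by apply: val_inj; rewrite /= inordK // /bump; lia.
  by rewrite raddfMz /F /= exprS mulN1r mulrNz.
rewrite -[in LHS]cs; apply: eq_bigr => i _.
rewrite /F (to_relative_face i yP); congr (- _).
exact/esym/(raddfMz (\pi_(RC n))).
Qed.

End ChainIsomorphism.

Theorem proposition3p4 (G : tree) (l : nat) (hl : 3 <= l)
    (x : l.+1.-tuple G) (hx : is_path x) :
  chain_iso (shift2 (magnitude_complex x))
            (opp_diff (relative_chains (Delta l) (Delta_path x))).
Proof.
exists (fun n => @to_relative G l x n : {additive _ -> _}).
split=> n; last exact: to_relative_diff.
by exists (@of_relative G l x n); [apply: to_relativeK | apply: of_relativeK].
Qed.
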